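(* There exists a stacked polyhedron that has no one-piece edge unfolding.
   Context: A polyhedron is a compact subset of $\mathbb{R}^3$ whose boundary surface is a closed embedded surface made of finitely many planar polygonal faces meeting edge-to-edge. A stacked polyhedron is one that can be formed from a single tetrahedron by repeatedly gluing a new tetrahedron onto a single triangular face of the current stacked polyhedron, face to face, so that the result is again a polyhedron. An edge unfolding is specified by a set of edges (the cut edges). Cutting the surface along them separates it into connected pieces. The unfolding is valid if each piece can be laid out isometrically in the plane, face by face, as a simple (non-self-overlapping) polygon. A one-piece edge unfolding is a valid edge unfolding with exactly one piece. *)

(* Defs.v *)
From HB Require Import structures.
From mathcomp Require Import all_boot all_order all_algebra.
From mathcomp Require Import all_classical all_reals topology normedtype.
From Stdlib Require Import Relations.

Set Implicit Arguments.
Unset Strict Implicit.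
Unset Printing Implicit Defensive.

Import Order.TTheory GRing.Theory Num.Theory.
Import numFieldNormedType.Exports.
Local Open Scope ring_scope.
Local Open Scope classical_set_scope.

Section Defs.
Variable R : realType.

Definition pt3 := 'rV[R]_3.
Definition pt2 := 'rV[R]_2.

Definition sqdist (n : nat) (x y : 'rV[R]_n) : R :=
  \sum_(i < n) (x ord0 i - y ord0 i) ^+ 2.

Definition det3 (u v w : pt3) : R :=
  let c (x : pt3) (i : nat) := x ord0 (inord i) in
  c u 0 * (c v 1 * c w 2 - c v 2 * c w 1)
  - c u 1 * (c v 0 * c w 2 - c v 2 * c w 0)
  + c u 2 * (c v 0 * c w 1 - c v 1 * c w 0).

(** nonzero iff the four points are affinely independent (not coplanar) *)
Definition det4 (a b c d : pt3) : R := det3 (b - a) (c - a) (d - a).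

Definition bary (k : nat) (l : 'rV[R]_k) : Prop :=
  (forall i, 0 <= l ord0 i) /\ \sum_(i < k) l ord0 i = 1.

Definition in_hull (n k : nat) (q : 'I_k -> 'rV[R]_n) (x : 'rV[R]_n) : Prop :=
  exists l : 'rV[R]_k, bary l /\ x = \sum_(i < k) l ord0 i *: q i.

Definition tri := (nat * nat * nat)%type.
Definition corner (t : tri) (i : 'I_3) : nat :=
  nth 0%N [:: t.1.1; t.1.2; t.2] i.

Definition tet_faces : seq tri := [:: (0,1,2); (0,1,3); (0,2,3); (1,2,3)]%N.

(** Boundary triangles after gluing, in order, new vertices m, m+1, ...
    onto the triangles listed in s: the glued triangle (a,b,c) is removed
    and replaced by (a,b,m), (b,c,m), (a,c,m). *)
Fixpoint stack_faces (m : nat) (s : seq tri) (F : seq tri) : seq tri :=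
  if s is t :: s' then
    stack_faces m.+1 s'
      (rem t F ++ [:: (t.1.1, t.1.2, m); (t.1.2, t.2, m); (t.1.1, t.2, m)])
  else F.

Definition faces_at (s : seq tri) (k : nat) : seq tri :=
  stack_faces 4 (take k s) tet_faces.

(** Tetrahedron number j (j = 3: the initial one; j = 4+i: the one glued at
    step i, with apex the new vertex 4+i), as its four vertices' indices. *)
Definition tet_verts (s : seq tri) (j : nat) (i : 'I_4) : nat :=
  if (j <= 3)%N then nat_of_ord i
  else let t := nth (0,0,0)%N s (j - 4) in
       nth 0%N [:: t.1.1; t.1.2; t.2; j] i.

Definition in_tet (p : nat -> pt3) (s : seq tri) (j : nat) (x : pt3) : Prop :=
  in_hull (fun i => p (tet_verts s j i)) x.

Definition in_tri (p : nat -> pt3) (t : tri) (x : pt3) : Prop :=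
  in_hull (fun i => p (corner t i)) x.

(** Two distinct boundary triangles sharing an edge are not coplanar, so that
    the faces of the polyhedron are exactly the triangles. *)
Definition no_flat_edges (p : nat -> pt3) (F : seq tri) : Prop :=
  forall t1 t2, t1 \in F -> t2 \in F ->
  forall i j k l : 'I_3, i != j -> corner t1 i = corner t2 k ->
    corner t1 j = corner t2 l ->
  forall d : 'I_3, (forall e : 'I_3, corner t2 d != corner t1 e) ->
    det4 (p (corner t1 ord0)) (p (corner t1 (inord 1))) (p (corner t1 (inord 2)))
         (p (corner t2 d)) != 0.

(** [stacked p s]: the tetrahedron p0 p1 p2 p3 followed by successive gluings
    of tetrahedra (a,b,c,4+i) onto boundary triangles (a,b,c) = nth s i, each
    result being a polyhedron: the new tetrahedron is nondegenerate, meets the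
    previous solid only in the glued triangle, and the boundary faces are the
    triangles. *)
Definition stacked (p : nat -> pt3) (s : seq tri) : Prop :=
  det4 (p 0%N) (p 1%N) (p 2%N) (p 3%N) != 0 /\
  (forall i, (i < size s)%N ->
     let t := nth (0,0,0)%N s i in
     let m := (4 + i)%N in
     [/\ t \in faces_at s i,
         det4 (p t.1.1) (p t.1.2) (p t.2) (p m) != 0 &
         forall x, in_tet p s m x ->
           (exists j, (3 <= j < m)%N /\ in_tet p s j x) -> in_tri p t x]) /\
  (forall k, (k <= size s)%N -> no_flat_edges p (faces_at s k)).

Section Unfold.
Variables (p : nat -> pt3) (F : seq tri).

Definition face (f : nat) : tri := nth (0,0,0)%N F f.

Definition share_edge (f g v w : nat) : Prop :=
  (f < size F)%N /\ (g < size F)%N /\ f <> g /\ v <> w /\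
  (exists i j : 'I_3, corner (face f) i = v /\ corner (face f) j = w) /\
  (exists i j : 'I_3, corner (face g) i = v /\ corner (face g) j = w).

Variable cut : nat -> nat -> bool.
Definition is_cut (v w : nat) : bool := cut v w || cut w v.

Definition glued (f g : nat) : Prop :=
  exists v w, share_edge f g v w /\ ~~ is_cut v w.

Definition one_piece : Prop :=
  forall f g, (f < size F)%N -> (g < size F)%N -> clos_refl_trans nat glued f g.

Definition pos3 (f : nat) (l : 'rV[R]_3) : pt3 :=
  \sum_(i < 3) l ord0 i *: p (corner (face f) i).

(** Points (f,l) and (g,m) are the same point of the cut surface: same point
    x in space, and f, g are linked by faces successively glued along uncut
    edges containing x. *)
Definition seg (a b x : pt3) : Prop :=
  exists u : R, 0 <= u <= 1 /\ x = (1 - u) *: a + u *: b.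
Definition glued_at (x : pt3) (f g : nat) : Prop :=
  exists v w, share_edge f g v w /\ ~~ is_cut v w /\ seg (p v) (p w) x.
Definition same_point (f : nat) (l : 'rV[R]_3) (g : nat) (m : 'rV[R]_3) : Prop :=
  pos3 f l = pos3 g m /\ clos_refl_trans nat (glued_at (pos3 f l)) f g.

(** A layout: face f is placed in the plane with its vertex v at L f v. *)
Variable L : nat -> nat -> pt2.

Definition pos2 (f : nat) (l : 'rV[R]_3) : pt2 :=
  \sum_(i < 3) l ord0 i *: L f (corner (face f) i).

Definition layout_isometric : Prop :=
  forall f, (f < size F)%N -> forall i j : 'I_3,
    sqdist (L f (corner (face f) i)) (L f (corner (face f) j)) =
    sqdist (p (corner (face f) i)) (p (corner (face f) j)).

Definition layout_glued : Prop :=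
  forall f g v w, share_edge f g v w -> ~~ is_cut v w ->
    L f v = L g v /\ L f w = L g w.

Definition layout_injective : Prop :=
  forall f g l m, (f < size F)%N -> (g < size F)%N -> bary l -> bary m ->
    pos2 f l = pos2 g m -> same_point f l g m.

Definition layout_image : set pt2 :=
  [set z | exists f l, (f < size F)%N /\ bary l /\ z = pos2 f l].

End Unfold.

Definition closed_disk : set pt2 :=
  [set z : pt2 | z ord0 ord0 ^+ 2 + z ord0 (inord 1) ^+ 2 <= 1].

Definition homeomorphic (A B : set pt2) : Prop :=
  exists (h k : pt2 -> pt2),
    [/\ (forall x, A x -> B (h x)), (forall y, B y -> A (k y)),
        (forall x, A x -> k (h x) = x), (forall y, B y -> h (k y) = y) &
        {within A, continuous h} /\ {within B, continuous k}].

(** A one-piece edge unfolding of the surface with faces F: a set of cut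
    edges leaving one piece, and an isometric face-by-face planar layout of
    that piece which is non-self-overlapping and whose image is a simple
    polygon (a polygonal region homeomorphic to a closed disk). *)
Definition has_one_piece_edge_unfolding (p : nat -> pt3) (F : seq tri) : Prop :=
  exists (cut : nat -> nat -> bool) (L : nat -> nat -> pt2),
    [/\ one_piece F cut,
        layout_isometric p F L,
        layout_glued F cut L,
        layout_injective p F cut L &
        homeomorphic (layout_image F L) closed_disk].

End Defs.

(* Main.v *)
(** The solid is a regular tetrahedron whose faces carry four congruent hats: a
    low pyramid over the face, each of whose three sides carries a long spike.
    Along a sequence of faces glued through uncut edges the layout is determined
    up to an isometry, since consecutive faces must lie on opposite sides of
    their common edge.  If the last face then overlaps the first one, or is the
    first one again but displaced, at least one of the edges crossed must be cut.
    Fifteen such sequences in each hat force 5 of its 12 inner edges to be cut,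
    hence at least 20 of the 54 edges are cut.  But the dual graph of the uncut
    edges connects the 36 faces, so that at most 54 - 35 = 19 edges are cut. *)

Require Import Defs.
From HB Require Import structures.
From Stdlib Require Import BinInt Relations.
From Stdlib Require QArith.
From mathcomp Require Import all_boot all_order all_algebra.
From mathcomp Require Import ssrZ zify ring lra.
From mathcomp Require Import all_classical all_reals topology normedtype.

Import QArith_base(Q, Qmake, Qnum, Qden, Qplus, Qmult, Qeq_bool, inject_Z).

Set Implicit Arguments.
Unset Strict Implicit.
Unset Printing Implicit Defensive.

Import Order.TTheory GRing.Theory Num.Theory.
Local Open Scope ring_scope.

(** * Integers and rationals inside the real field *)

Section Numbers.
Variable R : realType.

(** Finite checks are evaluated in [Z] and in [Q]; [zr] and [qr] carry their outcomes over to
    [R]. *)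
Definition zr (z : Z) : R := (int_of_Z z)%:~R.

Lemma zrD x y : zr (x + y) = zr x + zr y.
Proof. by rewrite /zr (rmorphD int_of_Z) intrD. Qed.

Lemma zrM x y : zr (x * y) = zr x * zr y.
Proof. by rewrite /zr (rmorphM int_of_Z) intrM. Qed.

Lemma zrN x : zr (- x) = - zr x.
Proof. by rewrite /zr (rmorphN int_of_Z) intrN. Qed.

Lemma zr_gt0 x : 0 < x -> 0 < zr x.
Proof.
by case: x => // q _; rewrite /zr /= ltr0z; have := Pos2Nat.is_pos q => /ssrnat.ltP.
Qed.

Lemma zr_ge0 x : 0 <= x -> 0 <= zr x.
Proof. by case: x => // q _; rewrite /zr /= ler0z. Qed.

Lemma zr_neq0 x : x != 0 -> zr x != 0.
Proof.
case: x => // q _; first by rewrite gt_eqF// zr_gt0.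
by rewrite -(opprK (zr _)) oppr_eq0 -zrN gt_eqF// zr_gt0.
Qed.

Definition qr (q : Q) : R := zr (Qnum q) / zr (Zpos (Qden q)).

Lemma qden_neq0 (d : positive) : zr (Zpos d) != 0.
Proof. exact: zr_neq0. Qed.

Lemma qrD a b : qr (Qplus a b) = qr a + qr b.
Proof.
rewrite /qr /Qplus /= Pos2Z.inj_mul !(zrM, zrD).
by field; rewrite !qden_neq0.
Qed.

Lemma qrM a b : qr (Qmult a b) = qr a * qr b.
Proof.
rewrite /qr /Qmult /= Pos2Z.inj_mul !zrM.
by field; rewrite !qden_neq0.
Qed.

Lemma qr_eq a b : Qeq_bool a b -> qr a = qr b.
Proof.
move=> /QArith_base.Qeq_bool_iff; rewrite /QArith_base.Qeq /qr => /(congr1 zr).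
rewrite !zrM => e.
by apply/eqP; rewrite eqr_div ?qden_neq0// e mulrC.
Qed.

Lemma qr_red a : qr (Qreduction.Qred a) = qr a.
Proof.
by apply: qr_eq; apply/QArith_base.Qeq_bool_iff; exact: Qreduction.Qred_correct.
Qed.

Lemma qr_gt0 a : 0 < Qnum a -> 0 < qr a.
Proof. by move=> h; rewrite divr_gt0// zr_gt0. Qed.

Lemma qr_neq0 a : Qnum a != 0 -> qr a != 0.
Proof. by move=> h; rewrite mulf_neq0 ?zr_neq0// invr_neq0// qden_neq0. Qed.

Lemma qr_inject z : qr (inject_Z z) = zr z.
Proof. by rewrite /qr /= divr1. Qed.
End Numbers.

(** * Triangles and squared distances *)

Section Plane.
Variable R : realType.

Definition dotv n (u w : 'rV[R]_n) := \sum_(i < n) u ord0 i * w ord0 i.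

Lemma dotvC n (u w : 'rV[R]_n) : dotv u w = dotv w u.
Proof. by apply: eq_bigr => i _; rewrite mulrC. Qed.

Lemma dotvDl n (u v w : 'rV[R]_n) x y :
  dotv (x *: u + y *: v) w = x * dotv u w + y * dotv v w.
Proof.
rewrite /dotv !mulr_sumr -big_split /=; apply: eq_bigr => i _.
by rewrite !mxE mulrDl !mulrA.
Qed.

Lemma dot0v n (w : 'rV[R]_n) : dotv 0 w = 0.
Proof. by rewrite /dotv big1// => i _; rewrite mxE mul0r. Qed.

Lemma sqdistC n (a b : 'rV[R]_n) : sqdist a b = sqdist b a.
Proof. by apply: eq_bigr => i _; rewrite -sqrrN opprB. Qed.

Lemma sqdist_dotv n (a b : 'rV[R]_n) : sqdist a b = dotv (b - a) (b - a).
Proof. by apply: eq_bigr => i _; rewrite !mxE; ring. Qed.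

Lemma sqdist_polar n (a b c : 'rV[R]_n) :
  sqdist b c = sqdist a b + sqdist a c - 2 * dotv (b - a) (c - a).
Proof.
rewrite /sqdist /dotv mulr_sumr -big_split /= -sumrB.
by apply: eq_bigr => i _; rewrite !mxE; ring.
Qed.

(* Heron's formula: sixteen times the squared area, from the squared side lengths. *)
Definition heron (ab ac bc : R) : R := 4 * ab * ac - (ab + ac - bc) ^+ 2.

Definition nondegenerate n (a b c : 'rV[R]_n) :=
  heron (sqdist a b) (sqdist a c) (sqdist b c) != 0.

(** The Heron expression is four times the Gram determinant of [b - a] and [c - a]. Pairing the
    relation with both vectors gives a linear system, solved by Cramer's rule. *)
Lemma nondegenerate_free n (a b c : 'rV[R]_n) x y :
  nondegenerate a b c -> x *: (b - a) + y *: (c - a) = 0 -> x = 0 /\ y = 0.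
Proof.
rewrite /nondegenerate /heron (sqdist_polar a b c) !sqdist_dotv.
set u := b - a; set w := c - a => h e.
have := dotvDl u w u x y; have := dotvDl u w w x y.
rewrite e !dot0v (dotvC w u); move: h.
set U := dotv u u; set W := dotv w w; set V := dotv u w => h e1 e2.
have h' : U * W - V ^+ 2 != 0.
  by apply: contra h => /eqP h; apply/eqP; rewrite -[RHS](mulr0 4) -h; ring.
split; apply: (mulIf h'); rewrite mul0r.
- transitivity (W * (x * U + y * V) - V * (x * V + y * W)); first by ring.
  by rewrite -e1 -e2 !mulr0 subr0.
- transitivity (U * (x * V + y * W) - V * (x * U + y * V)); first by ring.
  by rewrite -e1 -e2 !mulr0 subr0.
Qed.

Local Notation pt := 'rV[R]_2.
Definition px (a : pt) : R := a ord0 ord0.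
Definition py (a : pt) : R := a ord0 (lift ord0 ord0).

Lemma pt_eqP (a b : pt) : px a = px b -> py a = py b -> a = b.
Proof.
move=> ex ey; apply/rowP => i; case: (unliftP ord0 i) => [j ->|-> //].
by rewrite (ord1 j).
Qed.

Lemma sqdist2 (a b : pt) : sqdist a b = (px a - px b) ^+ 2 + (py a - py b) ^+ 2.
Proof. by rewrite /sqdist !big_ord_recl big_ord0 addr0. Qed.

(** Twice the signed area; its sign tells the side of the line [a b] on which [c] lies. *)
Definition cross (a b c : pt) : R :=
  (px b - px a) * (py c - py a) - (py b - py a) * (px c - px a).

Lemma cross_heron (a b c : pt) :
  4 * cross a b c ^+ 2 = heron (sqdist a b) (sqdist a c) (sqdist b c).
Proof. by rewrite /heron !sqdist2 /cross; ring. Qed.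

Lemma pxD (x y z : R) (a b c : pt) :
  px (x *: a + y *: b + z *: c) = x * px a + y * px b + z * px c.
Proof. by rewrite /px !mxE. Qed.

Lemma pyD (x y z : R) (a b c : pt) :
  py (x *: a + y *: b + z *: c) = x * py a + y * py b + z * py c.
Proof. by rewrite /py !mxE. Qed.

Lemma barycentric (a b c d : pt) : cross a b c != 0 ->
  exists x y, d = x *: a + y *: b + (cross a b d / cross a b c) *: c
    /\ x + y + cross a b d / cross a b c = 1.
Proof.
move=> h; exists (cross b c d / cross a b c), (cross c a d / cross a b c).
split; last by move: h; rewrite /cross => h; field.
by apply: pt_eqP; rewrite ?pxD ?pyD; move: h; rewrite /cross => h; field.
Qed.

(* The overlap is found next to the midpoint of the common edge. *)
Lemma same_side_overlap (a b c d : pt) : 0 < cross a b c * cross a b d ->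
  exists x y z u v w : R, [/\ [/\ 0 < x, 0 < y & 0 < z], [/\ 0 < u, 0 < v & 0 < w],
    x + y + z = 1, u + v + w = 1 &
    x *: a + y *: b + z *: c = u *: a + v *: b + w *: d].
Proof.
move=> h; have h0 : cross a b c != 0.
  by apply: contraTneq h => ->; rewrite mul0r ltxx.
have [x [y []]] := barycentric d h0; set g := _ / _ => -> e1.
have g0 : 0 < g.
  rewrite /g -(pmulr_lgt0 _ (_ : 0 < cross a b c ^+ 2)) ?exprn_even_gt0//.
  by rewrite expr2 mulrA divfK// mulrC.
(* The common point is the midpoint of [a b] moved by the fraction [1 / k] towards [d]. This [k] is
   large enough for its coordinates at [a], [b], [c] to stay positive. *)
pose k := 2 + 2 * `|x| + 2 * `|y|.
have k0 : 0 < k by rewrite /k; have := normr_ge0 x; have := normr_ge0 y; lra.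
have kx : 0 < (k - 1) / 2 + x.
  by rewrite /k; have := normr_ge0 y; have := ler_norm (- x); rewrite normrN; lra.
have ky : 0 < (k - 1) / 2 + y.
  by rewrite /k; have := normr_ge0 x; have := ler_norm (- y); rewrite normrN; lra.
have k1 : 0 < (k - 1) / 2.
  by rewrite /k; have := normr_ge0 x; have := normr_ge0 y; lra.
have kn : k != 0 by rewrite gt_eqF.
exists (((k - 1) / 2 + x) / k), (((k - 1) / 2 + y) / k), (g / k),
  (((k - 1) / 2) / k), (((k - 1) / 2) / k), (1 / k).
split.
- by split; rewrite divr_gt0 ?ltr01.
- by split; rewrite divr_gt0 ?ltr01.
- have -> : g = 1 - x - y by rewrite -e1; ring.
  by field.
- by field.
- by apply: pt_eqP; rewrite ?pxD ?pyD; field.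
Qed.

(** Prescribed distances to [a] and [b] leave two mirror images in the line [a b]. Since [z < 0],
    the combination lies across from [c], as [d] does, so both are the same image. *)
Lemma reflect_unique (a b c d : pt) (x y z : R) :
  cross a b c * cross a b d < 0 -> x + y + z = 1 -> z < 0 ->
  sqdist a d = sqdist a (x *: a + y *: b + z *: c) ->
  sqdist b d = sqdist b (x *: a + y *: b + z *: c) ->
  d = x *: a + y *: b + z *: c.
Proof.
set e := _ + z *: c => h s1 z0 ha hb.
have ce : cross a b e = z * cross a b c.
  have xE : x = 1 - y - z by rewrite -s1; ring.
  by rewrite /cross /e pxD pyD xE; ring.
have h1 : 0 < cross a b e * cross a b d.
  by rewrite ce -mulrA nmulr_rgt0.
have c2 : cross a b e ^+ 2 = cross a b d ^+ 2.
  have n4 : (4 : R) != 0 by rewrite pnatr_eq0.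
  by apply: (mulfI n4); rewrite !cross_heron ha hb.
have cde : cross a b e = cross a b d.
  have : (cross a b e - cross a b d) * (cross a b e + cross a b d) = 0.
    by rewrite -subr_sqr c2 subrr.
  move=> /eqP; rewrite mulf_eq0 subr_eq0 => /orP [/eqP //|].
  rewrite addr_eq0 => /eqP E; move: h1; rewrite E mulNr oppr_gt0.
  by rewrite -expr2 ltNge sqr_ge0.
have n0 : sqdist a b != 0.
  apply: contraTneq h => E; rewrite -leNgt.
  have := cross_heron a b c; rewrite E /heron => H.
  have : cross a b c ^+ 2 <= 0.
    by have := sqr_ge0 (0 + sqdist a c - sqdist b c); lra.
  rewrite le_eqVlt ltNge sqr_ge0 orbF sqrf_eq0 => /eqP ->.
  by rewrite mul0r.
(* The difference of the two points has zero dot and cross product with [b - a], which is not zero,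
   so it vanishes. *)
have dot0 : (px b - px a) * (px d - px e) + (py b - py a) * (py d - py e) = 0.
  by move: ha hb; rewrite !sqdist2; lra.
have crs0 : (px b - px a) * (py d - py e) - (py b - py a) * (px d - px e) = 0.
  by move: cde; rewrite /cross; lra.
apply: pt_eqP; apply/eqP; rewrite -subr_eq0; apply/eqP; apply: (mulfI n0);
  rewrite mulr0 sqdist2.
- transitivity ((px b - px a) * ((px b - px a) * (px d - px e)
      + (py b - py a) * (py d - py e)) - (py b - py a) * ((px b - px a) *
      (py d - py e) - (py b - py a) * (px d - px e))); first by ring.
  by rewrite dot0 crs0 !mulr0 subr0.
- transitivity ((py b - py a) * ((px b - px a) * (px d - px e)
      + (py b - py a) * (py d - py e)) + (px b - px a) * ((px b - px a) *
      (py d - py e) - (py b - py a) * (px d - px e))); first by ring.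
  by rewrite dot0 crs0 !mulr0 addr0.
Qed.
End Plane.

(** * Corners of triangles and the rational overlap test for walks *)

Definition corners (t : tri) : seq nat := [:: t.1.1; t.1.2; t.2].

Lemma cornerP (t : tri) v : (exists i, corner t i = v) <-> v \in corners t.
Proof.
split=> [[i <-]|]; first exact/mem_nth/ltn_ord.
move=> h; have hi : (index v (corners t) < 3)%N by rewrite index_mem.
by exists (Ordinal hi); rewrite /corner /= -/(corners t) nth_index.
Qed.

Lemma sum_corners (V : zmodType) (t : tri) (G : nat -> V) :
  \sum_(i < 3) G (corner t i) = \sum_(v <- corners t) G v.
Proof. by rewrite !big_ord_recl big_ord0 !big_cons big_nil. Qed.

Lemma third_corner (t : tri) v w : v \in corners t -> w \in corners t -> v <> w ->
  exists c, perm_eq (corners t) [:: v; w; c].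
Proof.
case: t => [[x y] z]; rewrite !inE /corners /=.
case/or3P=> /eqP-> /or3P[]/eqP-> // _.
- by exists z.
- by exists y; apply/permP => P /=; lia.
- by exists z; apply/permP => P /=; lia.
- by exists x; apply/permP => P /=; lia.
- by exists y; apply/permP => P /=; lia.
- by exists x; apply/permP => P /=; lia.
Qed.

(* Barycentric coordinates, in the plane of the layout, with respect to the
   corners of the first face of a walk. *)
Definition coords := (Q * Q * Q)%type.

Definition qsum (u : coords) : Q := Qplus u.1.1 (Qplus u.1.2 u.2).

(** Reducing the fractions keeps their size under control along a walk. *)
Definition qdot (c : coords) (x y z : Q) : Q := Qreduction.Qred
  (Qplus (Qmult c.1.1 x) (Qplus (Qmult c.1.2 y) (Qmult c.2 z))).
Arguments qdot : simpl never.

Definition qcomb (c u v w : coords) : coords :=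
  (qdot c u.1.1 v.1.1 w.1.1, qdot c u.1.2 v.1.2 w.1.2, qdot c u.2 v.2 w.2).

Definition qpositive (u : coords) : bool :=
  [&& 0 < Qnum u.1.1, 0 < Qnum u.1.2 & 0 < Qnum u.2].

Section Walks.
Variables (F : seq tri) (d : nat -> nat -> Z) (wt : nat -> Z).
Local Notation face := (face F).

(** The default values are harmless: [flip_ok] checks that hinge and apex really make up the corners
    of both faces. *)
Definition hinge (f g : nat) : nat * nat :=
  let s := [seq v <- corners (face f) | v \in corners (face g)] in
  (nth 0%N s 0, nth 0%N s 1).

Definition apex (f g : nat) : nat :=
  head 0%N [seq v <- corners (face f) | v \notin corners (face g)].

(* [apex g f] in barycentric coordinates with respect to the hinge and
   [apex f g], for [g] unfolded around its hinge with [f].  Its last coordinate is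
   minus a ratio of areas, which is assumed to be the rational [wt g / wt f];
   [flip_ok] checks the result against the edge lengths. *)
Definition flip (f g : nat) : coords :=
  let: (a, b) := hinge f g in
  let proj c := Qmult (inject_Z (d a c - d b c + d a b))
                  (QArith_base.Qinv (inject_Z (d a b + d a b))) in
  let ga := Qmult (inject_Z (- wt g)) (QArith_base.Qinv (inject_Z (wt f))) in
  let be := Qplus (proj (apex g f)) (QArith_base.Qopp (Qmult ga (proj (apex f g)))) in
  (Qplus (Qmake 1 1) (QArith_base.Qopp (Qplus be ga)), be, ga).

(* The squared distance from [a] to [(1 - be - ga) a + be b + ga c]. *)
Definition flip_dist (be ga : Q) (ab ac bc : Z) : Q :=
  Qplus (Qmult (Qmult be be) (inject_Z ab))
    (Qplus (Qmult (Qmult ga ga) (inject_Z ac))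
           (Qmult (Qmult be ga) (inject_Z (ab + ac - bc)))).

(** Besides the combinatorics of the hinge, these are the rational hypotheses of [reflect_unique],
    so that the formula for [flip] needs no separate justification. The last test exchanges the two
    ends of the hinge. *)
Definition flip_ok (f g : nat) : bool :=
  let: (a, b) := hinge f g in
  let c := apex f g in let e := apex g f in
  let k := flip f g in
  [&& (f < size F)%N && (g < size F)%N, f != g,
      perm_eq (corners (face f)) [:: a; b; c],
      perm_eq (corners (face g)) [:: a; b; e],
      a != b, Qeq_bool (qsum k) (Qmake 1 1), Qnum k.2 < 0,
      Qeq_bool (flip_dist k.1.2 k.2 (d a b) (d a c) (d b c)) (inject_Z (d a e))
    & Qeq_bool (flip_dist k.1.1 k.2 (d a b) (d b c) (d a c)) (inject_Z (d b e))].

(* [m] is the overlap witness: a point of the last face, inside the first one. *)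
Definition clash (f0 f : nat) (pos : nat -> coords) (m : coords) : bool :=
  let x := (face f).1.1 in let y := (face f).1.2 in let z := (face f).2 in
  if f0 == f then
    Qeq_bool (qsum (pos x)) (Qmake 1 1) &&
    ((Qnum (pos x).1.2 != 0) || (Qnum (pos x).2 != 0))
  else
    let l := qcomb m (pos x) (pos y) (pos z) in
    [&& qpositive m, Qeq_bool (qsum m) (Qmake 1 1), qpositive l
      & Qeq_bool (qsum l) (Qmake 1 1)].

(** Only the values of [pos] at the corners of the current face matter. Crossing a hinge overwrites
    the new corner alone, so a vertex met again may receive another position. *)
Fixpoint walk_ok (f0 f : nat) (pos : nat -> coords) (w : seq nat) (m : coords) : bool :=
  if w is g :: w' then
    flip_ok f g &&
    let e := apex g f in
    let q := qcomb (flip f g)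
      (pos (hinge f g).1) (pos (hinge f g).2) (pos (apex f g)) in
    walk_ok f0 g (fun v => if v == e then q else pos v) w' m
  else (f0 < size F)%N && (f < size F)%N && clash f0 f pos m.

Fixpoint walk_edges (f : nat) (w : seq nat) : seq (nat * nat) :=
  if w is g :: w' then hinge f g :: walk_edges g w' else [::].

Definition start (f : nat) (v : nat) : coords :=
  let i := Qmake 1 1 in let o := Qmake 0 1 in
  if v == (face f).1.1 then (i, o, o) else
  if v == (face f).1.2 then (o, i, o) else (o, o, i).

Definition overlapping (w : seq nat) (m : coords) : bool :=
  if w is f :: w' then walk_ok f f (start f) w' m else false.

End Walks.
Arguments hinge : simpl never.
Arguments apex : simpl never.
Arguments flip : simpl never.

(** * Layouts and the soundness of the overlap test *)

Section Layouts.
Variable R : realType.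
Variables (p : nat -> 'rV[R]_3) (F : seq tri) (cut : nat -> nat -> bool).
Variable L : nat -> nat -> 'rV[R]_2.
Hypothesis Liso : layout_isometric p F L.
Hypothesis Lglued : layout_glued F cut L.
Hypothesis Linj : layout_injective p F cut L.
Hypothesis Fnd : forall f, (f < size F)%N -> forall a b c,
  perm_eq (corners (face F f)) [:: a; b; c] -> nondegenerate (p a) (p b) (p c).

Local Notation face := (face F).

Lemma big3 (V : zmodType) (G : nat -> V) a b c :
  \sum_(v <- [:: a; b; c]) G v = G a + G b + G c.
Proof. by rewrite !big_cons big_nil addr0 addrA. Qed.

(** A point of an edge has weight zero at the opposite corner, and the weights in a nondegenerate
    triangle are unique. *)
Lemma interior_not_glued f a b c x h (l : nat -> R) :
  (f < size F)%N -> perm_eq (corners (face f)) [:: a; b; c] ->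
  0 < l a -> 0 < l b -> 0 < l c -> l a + l b + l c = 1 ->
  x = l a *: p a + l b *: p b + l c *: p c -> ~ glued_at p F cut x f h.
Proof.
move=> fF fp la lb lc l1 xE [v [w [[_ [_ [_ [vw [[i [j [vi wj]]] _]]]]] [_ [u [_ xE']]]]]].
have vf : v \in corners (face f) by apply/cornerP; exists i.
have wf : w \in corners (face f) by apply/cornerP; exists j.
have [d dp] := third_corner vf wf vw.
have sub e : e \in [:: v; w; d] -> 0 < l e.
  rewrite -(perm_mem dp) (perm_mem fp) !inE.
  by case/or3P=> /eqP->.
have perm2 : perm_eq [:: a; b; c] [:: v; w; d] by apply: perm_trans dp; rewrite perm_sym.
have E1 : l v + l w + l d = 1.
  by rewrite -l1 -[LHS](big3 l) -[RHS](big3 l); apply/esym/perm_big.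
have E2 : x = l v *: p v + l w *: p w + l d *: p d.
  rewrite xE -[LHS](big3 (fun e => l e *: p e)) -[RHS](big3 (fun e => l e *: p e)).
  exact: perm_big.
have [_ ld0] : l w - u = 0 /\ l d = 0.
  apply: (nondegenerate_free (Fnd fF dp)).
  have lvE : l v = 1 - l w - l d by rewrite -E1; ring.
  have := subrr x; rewrite {1}E2 {1}xE' lvE => <-.
  by apply/rowP => k; rewrite !mxE; ring.
by have := sub d; rewrite !inE eqxx !orbT ld0 ltxx => /(_ isT).
Qed.

(** By injectivity the two points agree on the cut surface, hence a chain of gluings at that point
    leads from [f] to [g]. The point is interior to [f], so the chain has no first step. *)
Lemma overlap_same_face f g a b c a' b' c' (l m : nat -> R) :
  (f < size F)%N -> (g < size F)%N ->
  perm_eq (corners (face f)) [:: a; b; c] ->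
  perm_eq (corners (face g)) [:: a'; b'; c'] ->
  [/\ 0 < l a, 0 < l b & 0 < l c] -> [/\ 0 < m a', 0 < m b' & 0 < m c'] ->
  l a + l b + l c = 1 -> m a' + m b' + m c' = 1 ->
  l a *: L f a + l b *: L f b + l c *: L f c =
  m a' *: L g a' + m b' *: L g b' + m c' *: L g c' ->
  f = g.
Proof.
move=> fF gF fp gp [la lb lc] [ma mb mc] l1 m1 E.
pose row (t : tri) (k : nat -> R) : 'rV[R]_3 := \row_i k (corner t i).
have sumrow t k x y z (V : lmodType R) (G : nat -> V) : perm_eq (corners t) [:: x; y; z] ->
    \sum_(i < 3) row t k ord0 i *: G (corner t i) = k x *: G x + k y *: G y + k z *: G z.
  move=> tp; under eq_bigr do rewrite mxE.
  rewrite (sum_corners t (fun e => k e *: G e)) (perm_big _ tp).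
  by rewrite (big3 (fun e => k e *: G e)).
have baryrow t k x y z : perm_eq (corners t) [:: x; y; z] ->
    0 < k x -> 0 < k y -> 0 < k z -> k x + k y + k z = 1 -> bary (row t k).
  move=> tp kx ky kz k1; split.
    move=> i; rewrite mxE; have : corner t i \in [:: x; y; z].
      by rewrite -(perm_mem tp); apply/cornerP; exists i.
    by rewrite !inE => /or3P[]/eqP->; exact: ltW.
  under eq_bigr do rewrite mxE.
  by rewrite (sum_corners t k) (perm_big _ tp) (big3 k).
have [_] := Linj fF gF (baryrow _ _ _ _ _ fp la lb lc l1)
  (baryrow _ _ _ _ _ gp ma mb mc m1)
  (etrans (sumrow _ l _ _ _ _ (L f) fp) (etrans E (esym (sumrow _ m _ _ _ _ (L g) gp)))).
rewrite /pos3 (sumrow _ l _ _ _ _ p fp) => /clos_rt_rt1n_iff.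
case=> // h k hfh _.
by have := interior_not_glued fF fp la lb lc l1 erefl hfh.
Qed.

Variable d : nat -> nat -> Z.
Hypothesis dE : forall v w, zr R (d v w) = sqdist (p v) (p w).
Variable wt : nat -> Z.

Lemma layout_sqdist f v w : (f < size F)%N ->
  v \in corners (face f) -> w \in corners (face f) ->
  sqdist (L f v) (L f w) = sqdist (p v) (p w).
Proof. by move=> fF /cornerP[i <-] /cornerP[j <-]; exact: Liso. Qed.

Lemma layout_nondegenerate f a b c : (f < size F)%N ->
  perm_eq (corners (face f)) [:: a; b; c] ->
  nondegenerate (L f a) (L f b) (L f c).
Proof.
move=> fF fp; have := Fnd fF fp; rewrite /nondegenerate.
by rewrite !(@layout_sqdist f)// (perm_mem fp) !inE eqxx ?orbT.
Qed.

Lemma cross_neq0 (a b c : 'rV[R]_2) : nondegenerate a b c -> cross a b c != 0.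
Proof.
rewrite /nondegenerate -cross_heron; apply: contra => /eqP ->.
by rewrite expr0n mulr0.
Qed.

Lemma share_edgeI f g a b c e : (f < size F)%N -> (g < size F)%N -> f <> g ->
  a <> b -> perm_eq (corners (face f)) [:: a; b; c] ->
  perm_eq (corners (face g)) [:: a; b; e] -> share_edge F f g a b.
Proof.
move=> fF gF fg ab fp gp; do 4 split=> //.
split.
- have /cornerP[i ia] : a \in corners (face f) by rewrite (perm_mem fp) !inE eqxx.
  have /cornerP[j jb] : b \in corners (face f) by rewrite (perm_mem fp) !inE eqxx orbT.
  by exists i, j.
- have /cornerP[i ia] : a \in corners (face g) by rewrite (perm_mem gp) !inE eqxx.
  have /cornerP[j jb] : b \in corners (face g) by rewrite (perm_mem gp) !inE eqxx orbT.
  by exists i, j.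
Qed.

Lemma sqdist_comb (a b c : 'rV[R]_2) (x y z : R) : x + y + z = 1 ->
  sqdist a (x *: a + y *: b + z *: c) = y ^+ 2 * sqdist a b + z ^+ 2 * sqdist a c
    + y * z * (sqdist a b + sqdist a c - sqdist b c).
Proof.
move=> s1; have xE : x = 1 - y - z by rewrite -s1; ring.
by rewrite !sqdist2 pxD pyD xE; ring.
Qed.

Lemma face_uniq f a b c : (f < size F)%N ->
  perm_eq (corners (face f)) [:: a; b; c] -> uniq [:: a; b; c].
Proof.
move=> fF fp; have := Fnd fF fp; rewrite /nondegenerate /heron => h.
have s0 (x : 'rV[R]_3) : sqdist x x = 0 by rewrite sqdist_dotv subrr dot0v.
rewrite /= !inE negb_or andbT; apply/andP; split; first (apply/andP; split).
all: apply: contra h => /eqP ->; rewrite s0; apply/eqP.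
- by ring.
- by rewrite (sqdistC (p c)); ring.
- by ring.
Qed.

Lemma overlap_eq_face f g a b c a' b' c' (x y z u v w : R) :
  (f < size F)%N -> (g < size F)%N ->
  perm_eq (corners (face f)) [:: a; b; c] ->
  perm_eq (corners (face g)) [:: a'; b'; c'] ->
  [/\ 0 < x, 0 < y & 0 < z] -> [/\ 0 < u, 0 < v & 0 < w] ->
  x + y + z = 1 -> u + v + w = 1 ->
  x *: L f a + y *: L f b + z *: L f c =
  u *: L g a' + v *: L g b' + w *: L g c' ->
  f = g.
Proof.
move=> fF gF fp gp xyz0 uvw0 xyz uvw E.
(* Weights listed by position become a function of the vertices, which is possible because the
   corners are distinct. *)
pose W (r s : nat) (k l m : R) t := if t == r then k else if t == s then l else m.
have WE r s t k l m : uniq [:: r; s; t] ->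
    [/\ W r s k l m r = k, W r s k l m s = l & W r s k l m t = m].
  rewrite /W /= !inE negb_or andbT => /andP[/andP[rs rt] st].
  by rewrite !eqxx ![_ == r]eq_sym (negPf rs) (negPf rt) eq_sym (negPf st).
have [f1 f2 f3] := WE _ _ _ x y z (face_uniq fF fp).
have [g1 g2 g3] := WE _ _ _ u v w (face_uniq gF gp).
by apply: (overlap_same_face (l := W a b x y z) (m := W a' b' u v w)
  fF gF fp gp); rewrite ?f1 ?f2 ?f3 ?g1 ?g2 ?g3.
Qed.

(** With both apices on one side of the common edge, the two triangles would overlap next to it, and
    injectivity would make them one face. *)
Lemma opposite_sides f g a b c e : (f < size F)%N -> (g < size F)%N -> f <> g ->
  perm_eq (corners (face f)) [:: a; b; c] ->
  perm_eq (corners (face g)) [:: a; b; e] ->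
  L f a = L g a -> L f b = L g b ->
  cross (L f a) (L f b) (L f c) * cross (L f a) (L f b) (L g e) < 0.
Proof.
move=> fF gF fg fp gp La Lb; rewrite lt_neqAle mulf_neq0 /=; last first.
- by rewrite La Lb; apply: cross_neq0; exact: layout_nondegenerate.
- by apply: cross_neq0; exact: layout_nondegenerate.
rewrite leNgt; apply/negP => /same_side_overlap.
move=> [x [y [z [u [v [w [xyz0 uvw0 xyz uvw E]]]]]]].
apply: fg; apply: (overlap_eq_face fF gF fp gp xyz0 uvw0 xyz uvw).
by rewrite -La -Lb.
Qed.

Definition qpoint (c : coords) (x y z : 'rV[R]_2) :=
  qr R c.1.1 *: x + qr R c.1.2 *: y + qr R c.2 *: z.

Lemma qsum1 c : Qeq_bool (qsum c) (Qmake 1 1) ->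
  qr R c.1.1 + qr R c.1.2 + qr R c.2 = 1.
Proof.
move=> /(qr_eq R); rewrite !qrD addrA => ->.
by rewrite /qr /= divff// qden_neq0.
Qed.

Lemma qpoint_comb c u v w x y z :
  qpoint (qcomb c u v w) x y z =
  qpoint c (qpoint u x y z) (qpoint v x y z) (qpoint w x y z).
Proof.
rewrite /qpoint /qcomb /= /qdot !qr_red !(qrD, qrM).
by apply/rowP => k; rewrite !mxE; ring.
Qed.

Lemma qpositiveP c : qpositive c ->
  [/\ 0 < qr R c.1.1, 0 < qr R c.1.2 & 0 < qr R c.2].
Proof. by case/and3P => h1 h2 h3; split; exact: qr_gt0. Qed.

Lemma flip_sound f g : flip_ok F d wt f g ->
  ~~ is_cut cut (hinge F f g).1 (hinge F f g).2 ->
  let: (a, b) := hinge F f g in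
  [/\ L g a = L f a, L g b = L f b &
      L g (apex F g f) = qpoint (flip F d wt f g) (L f a) (L f b) (L f (apex F f g))].
Proof.
rewrite /flip_ok; move: (flip F d wt f g) => k.
set c := apex F f g; set e := apex F g f; case: (hinge F f g) => a b.
case/and5P => /andP[fF gF] /eqP fg fp gp /and5P[/eqP ab /qsum1 k1 k0].
move=> /(qr_eq R) Ha /(qr_eq R) Hb nc.
have [La Lb] := Lglued (share_edgeI fF gF fg ab fp gp) nc.
split=> //.
move: Ha Hb; rewrite /flip_dist !(qrD, qrM) !qr_inject !(zrD, zrN) !dE.
have [Fa Fb Fc] : [/\ a \in corners (face f), b \in corners (face f) & c \in corners (face f)].
  by rewrite !(perm_mem fp) !inE !eqxx !orbT.
have [Ga Gb Ge] : [/\ a \in corners (face g), b \in corners (face g) & e \in corners (face g)].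
  by rewrite !(perm_mem gp) !inE !eqxx !orbT.
rewrite -(layout_sqdist fF Fa Fb) -(layout_sqdist fF Fa Fc) -(layout_sqdist fF Fb Fc).
rewrite -(layout_sqdist gF Ga Ge) -(layout_sqdist gF Gb Ge) -La -Lb => Ha Hb.
apply: reflect_unique => //.
- exact: opposite_sides.
- by rewrite /qr pmulr_llt0 ?invr_gt0 ?zr_gt0// -oppr_gt0 -zrN zr_gt0// oppr_gt0.
- by rewrite (sqdist_comb _ _ _ k1) -Ha; ring.
- have k1' : qr R k.1.2 + qr R k.1.1 + qr R k.2 = 1 by rewrite -k1; ring.
  rewrite (addrC (_ *: _)) (sqdist_comb _ _ _ k1') -Hb.
  by rewrite (sqdistC (L f b) (L f a)); ring.
Qed.

(** As long as the hinges crossed are uncut, [flip_sound] keeps [pos] correct at the corners of the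
    current face; at the end a clash contradicts injectivity or nondegeneracy. *)
Lemma walk_sound f0 f pos w m : walk_ok F d wt f0 f pos w m ->
  (forall v, v \in corners (face f) ->
    L f v = qpoint (pos v) (L f0 (face f0).1.1) (L f0 (face f0).1.2)
      (L f0 (face f0).2)) ->
  has (fun e => is_cut cut e.1 e.2) (walk_edges F f w).
Proof.
elim: w f pos => [|g w IH] f pos.
  case/andP => /andP[f0F fF]; rewrite /clash /=.
  have fp : perm_eq (corners (face f)) [:: (face f).1.1; (face f).1.2; (face f).2] by [].
  have fp0 : perm_eq (corners (face f0))
      [:: (face f0).1.1; (face f0).1.2; (face f0).2] by [].
  have [Ex Ey Ez] : [/\ (face f).1.1 \in corners (face f),
      (face f).1.2 \in corners (face f) & (face f).2 \in corners (face f)].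
    by rewrite !inE !eqxx !orbT.
  have [ff|nff] := eqVneq f0 f.
    (* Back at the first face, its first corner would equal an affine combination of the three
       corners other than the trivial one. *)
    subst f0; case/andP => /qsum1 s1 nz H; exfalso.
    have := H _ Ex; rewrite {1}/qpoint; set c := pos _ in s1 nz *.
    move=> Hx; have [y0 z0] : qr R c.1.2 = 0 /\ qr R c.2 = 0.
      apply: (nondegenerate_free (layout_nondegenerate fF fp)).
      have := subrr (L f (face f).1.1); rewrite {1}Hx.
      rewrite (_ : qr R c.1.1 = 1 - qr R c.1.2 - qr R c.2); last by rewrite -s1; ring.
      by move=> <-; apply/rowP => k; rewrite !mxE; ring.
    by case/orP: nz => /(qr_neq0 R); rewrite ?y0 ?z0 eqxx.
  case/and4P => m0 /qsum1 m1 l0 /qsum1 l1 H; exfalso.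
  move/eqP: nff; apply.
  (* The witness has weights [m] in the last face; substituting the positions of its corners gives
     its weights in the first face. *)
  apply: (overlap_eq_face f0F fF fp0 fp (qpositiveP l0) (qpositiveP m0) l1 m1).
  by rewrite -[LHS]/(qpoint _ _ _ _) qpoint_comb -!H.
rewrite -[has _ _]/(is_cut cut (hinge F f g).1 (hinge F f g).2
  || has (fun e => is_cut cut e.1 e.2) (walk_edges F g w)).
move=> /andP[fok]; have := flip_sound fok; move: (fok); rewrite /flip_ok.
case: (hinge F f g) => a b /and5P[/andP[fF gF] _ fp gp _] sound wok H.
have [//|nab] := boolP (is_cut cut a b); have [La Lb Le] := sound nab.
apply: (IH _ _ wok) => v; rewrite (perm_mem gp) !inE.
have mem e : e \in [:: a; b; apex F f g] -> L f e = qpoint (pos e)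
    (L f0 (face f0).1.1) (L f0 (face f0).1.2) (L f0 (face f0).2).
  by rewrite -(perm_mem fp); exact: H.
have [-> _|_] := eqVneq v (apex F g f).
  by rewrite Le qpoint_comb !mem ?inE ?eqxx ?orbT.
by rewrite orbF => /orP[]/eqP ->; rewrite ?La ?Lb mem ?inE ?eqxx ?orbT.
Qed.

Lemma overlapping_sound w m : overlapping F d wt w m ->
  has (fun e => is_cut cut e.1 e.2) (walk_edges F (head 0%N w) (behead w)).
Proof.
case: w => // f w /walk_sound; apply => v.
have q1 : qr R (Qmake 1 1) = 1 by rewrite /qr divff// qden_neq0.
have q0 : qr R (Qmake 0 1) = 0 by rewrite /qr /= /zr mul0r.
rewrite !inE /start /qpoint.
have [-> _|_] := eqVneq v; first by rewrite /= q0 q1 scale1r !scale0r !addr0.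
have [-> _|_] := eqVneq v; first by rewrite /= q0 q1 scale1r !scale0r addr0 add0r.
by move=> /= /eqP ->; rewrite q0 q1 scale1r !scale0r !add0r.
Qed.
End Layouts.

(** * Connected graphs and hitting sets *)

(** A colouring constant along every edge can keep at least [n - size es] colours, while
    connectedness allows only one. It is built from the identity by merging two colours per edge. *)
Lemma connected_leq_edges n (es : seq (nat * nat)) (r : nat -> nat -> Prop) :
  (forall f g, r f g -> (f, g) \in es \/ (g, f) \in es) ->
  (forall f g, (f < n)%N -> (g < n)%N -> clos_refl_trans nat r f g) ->
  (n <= (size es).+1)%N.
Proof.
move=> res conn.
suff [c [cE cn]] : exists c : nat -> nat,
    {in es, forall e, c e.1 = c e.2} /\
    (n <= size (undup (map c (iota 0 n))) + size es)%N.
  have rc f g : r f g -> c f = c g.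
    by move=> /res[/cE //|/cE /= ->].
  have cc f g : clos_refl_trans nat r f g -> c f = c g.
    by elim=> {f g} [f g /rc||f g h _ -> _ ->].
  apply: leq_trans cn _; rewrite -[_.+1]add1n leq_add2r.
  case: n conn => // n conn.
  apply: (@uniq_leq_size _ _ [:: c 0%N]); first exact: undup_uniq.
  move=> y; rewrite mem_undup => /mapP[x]; rewrite mem_iota inE => /andP[_ xn] ->.
  by apply/eqP/cc/conn.
elim: es {res} => [|[a b] es [c [cE cn]]].
  exists id; split=> //; rewrite map_id undup_id ?iota_uniq// size_iota.
  by rewrite addn0.
(* Recolouring the class of [a] like [b] can lose only the colour [c a]. *)
exists (fun x => if c x == c a then c b else c x); split.
  move=> e; rewrite inE => /predU1P[-> /=|/cE -> //].
  by rewrite eqxx; case: ifP.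
apply: leq_trans cn _; rewrite /= addnS -addSn leq_add2r.
set s := map c _; set s' := map _ _.
apply: leq_trans (_ : (size (rem (c a) (undup s))).+1 <= _)%N.
  have [h|h] := boolP (c a \in undup s); last by rewrite rem_id.
  by rewrite size_rem// prednK//; case: (undup s) h.
rewrite ltnS; apply: uniq_leq_size; first by rewrite rem_uniq// undup_uniq.
move=> y; rewrite mem_rem_uniq ?undup_uniq// !inE !mem_undup => /andP[ya /mapP[x xn yE]].
by apply/mapP; exists x => //; rewrite -yE (negPf ya).
Qed.

(** All candidate cut sets among [n] edges, for an exhaustive search. *)
Fixpoint bitseqs (n : nat) : seq (seq bool) :=
  if n is n'.+1 then [seq true :: b | b <- bitseqs n'] ++ [seq false :: b | b <- bitseqs n']
  else [:: [::]].

Lemma mem_bitseqs (b : seq bool) : b \in bitseqs (size b).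
Proof.
elim: b => // x b IH; rewrite mem_cat; apply/orP.
by case: x; [left|right]; apply: map_f.
Qed.

(* [cl] lists the sets to be hit, as index sequences below [n]. *)
Definition hitting_number_geq (n k : nat) (cl : seq (seq nat)) : bool :=
  all (fun b => all (has (nth false b)) cl ==> (k <= count id b)%N) (bitseqs n).

(** The search runs over index sets; [c] enters it as the bit sequence [map c es]. *)
Lemma count_hitting (T : eqType) (es : seq T) (cl : seq (seq T)) (k : nat) (c : pred T) :
  all (all (mem es)) cl ->
  hitting_number_geq (size es) k [seq [seq index e es | e <- w] | w <- cl] ->
  all (has c) cl -> (k <= count c es)%N.
Proof.
move=> /allP cles /allP /(_ (map c es)); rewrite -{1}(size_map c) mem_bitseqs.
move=> /(_ isT) /implyP; rewrite count_map => H /allP hc; apply: H.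
apply/allP => _ /mapP[w wcl ->]; have /hasP[e ew ce] := hc _ wcl.
apply/hasP; exists (index e es); first exact: map_f.
have ees : e \in es by have /allP /(_ _ ew) := cles _ wcl.
by rewrite (nth_map e) ?index_mem// nth_index.
Qed.

Lemma count_flatten_geq (T : eqType) (c : pred T) (s r : seq T) (ss : seq (seq T)) (k : nat) :
  perm_eq s (flatten ss ++ r) -> {in ss, forall x, (k <= count c x)%N} ->
  (size ss * k <= count c s)%N.
Proof.
move=> /permP -> kss; rewrite count_cat; apply: leq_trans (leq_addr _ _).
elim: ss kss => // x ss IH kss; rewrite /= count_cat mulSn leq_add ?kss ?mem_head//.
by apply: IH => y yss; apply: kss; rewrite inE yss orbT.
Qed.

(** * Polyhedra with integer vertices *)

Definition zpoint := (Z * Z * Z)%type.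

Definition zcoord (v : zpoint) (i : nat) : Z := nth v.2 [:: v.1.1; v.1.2] i.

Definition zsub (a b : zpoint) : zpoint :=
  (a.1.1 - b.1.1, a.1.2 - b.1.2, a.2 - b.2).

Definition zdot (a b : zpoint) : Z := a.1.1 * b.1.1 + a.1.2 * b.1.2 + a.2 * b.2.

Definition zcross (a b : zpoint) : zpoint :=
  (a.1.2 * b.2 - a.2 * b.1.2, a.2 * b.1.1 - a.1.1 * b.2, a.1.1 * b.1.2 - a.1.2 * b.1.1).

Section Integral.
Variables (R : realType) (P : nat -> zpoint).

Definition zpt (n : nat) : 'rV[R]_3 := \row_i zr R (zcoord (P n) i).

Definition zdist (a b : nat) : Z := let u := zsub (P a) (P b) in zdot u u.

Lemma zdistE a b : zr R (zdist a b) = sqdist (zpt a) (zpt b).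
Proof.
rewrite /sqdist !big_ord_recl big_ord0 !mxE /zdist /zdot /= !(zrD, zrM, zrN).
by rewrite /zcoord /=; ring.
Qed.

Definition zdet (a b c e : nat) : Z :=
  zdot (zsub (P b) (P a)) (zcross (zsub (P c) (P a)) (zsub (P e) (P a))).

Lemma zdetE a b c e : zr R (zdet a b c e) = det4 (zpt a) (zpt b) (zpt c) (zpt e).
Proof.
rewrite /det4 /det3 !mxE !inordK// /zcoord /= /zdet /zdot /zcross /=.
by rewrite !(zrD, zrM, zrN); ring.
Qed.

Lemma det4_neq0 a b c e : zdet a b c e != 0 ->
  det4 (zpt a) (zpt b) (zpt c) (zpt e) != 0.
Proof. by move=> h; rewrite -zdetE zr_neq0. Qed.

Definition zheron (a b c : nat) : Z :=
  let ab := zdist a b in let ac := zdist a c in let s := ab + ac - zdist b c in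
  (ab * ac + ab * ac) + (ab * ac + ab * ac) - s * s.

Lemma zheron_nondegenerate a b c : zheron a b c != 0 ->
  nondegenerate (zpt a) (zpt b) (zpt c).
Proof.
move=> /(zr_neq0 R); rewrite /nondegenerate /heron -!zdistE => h.
apply: contra h => /eqP h; apply/eqP; rewrite -h /zheron !(zrD, zrM, zrN).
by ring.
Qed.

Definition zside (n : zpoint) (c : Z) (v : nat) : Z := zdot n (P v) - c.

Definition side (n : zpoint) (c : Z) (x : 'rV[R]_3) : R :=
  \sum_(i < 3) zr R (zcoord n i) * x ord0 i - zr R c.

Lemma zsideE n c v : zr R (zside n c v) = side n c (zpt v).
Proof.
rewrite /side !big_ord_recl big_ord0 !mxE /zside /zdot !(zrD, zrM, zrN).
by rewrite /zcoord /=; ring.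
Qed.

Lemma side_hull n c k (l : 'rV[R]_k) (q : 'I_k -> 'rV[R]_3) : bary l ->
  side n c (\sum_i l ord0 i *: q i) = \sum_i l ord0 i * side n c (q i).
Proof.
move=> [_ l1]; rewrite /side.
under [RHS]eq_bigr do rewrite mulrBr mulr_sumr.
rewrite sumrB -mulr_suml l1 mul1r exchange_big /=; congr (_ - _).
apply: eq_bigr => j _; rewrite summxE mulr_sumr.
by apply: eq_bigr => i _; rewrite !mxE mulrCA.
Qed.

(** The plane may touch both tetrahedra; strictness at the new apex [m] alone confines the
    intersection to the glued triangle. *)
Definition separates (n : zpoint) (c : Z) (t : tri) (m : nat) (u : seq nat) : bool :=
  [&& all (fun v => 0 <= zside n c v) (corners t), 0 < zside n c m
    & all (fun v => zside n c v <= 0) u].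

Lemma separates_sound n c t m (u : 'I_4 -> nat) x :
  separates n c t m [seq u i | i <- enum 'I_4] ->
  in_hull (fun i : 'I_4 => zpt (nth 0%N [:: t.1.1; t.1.2; t.2; m] i)) x ->
  in_hull (fun i => zpt (u i)) x -> in_tri zpt t x.
Proof.
move=> /and3P[/allP tn mn /allP un] [l [lb ->]] [k [kb]].
move=> /(congr1 (side n c)); rewrite !side_hull// => E.
have [l0 l1] := lb; have [k0 _] := kb.
have rhs0 : \sum_i k ord0 i * side n c (zpt (u i)) <= 0.
  apply: sumr_le0 => i _; apply: mulr_ge0_le0 => //.
  rewrite -zsideE -oppr_ge0 -zrN zr_ge0// oppr_ge0 un//.
  by apply: map_f; rewrite mem_enum.
have tpos (i : 'I_3) : 0 <= side n c (zpt (corner t i)).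
  by rewrite -zsideE zr_ge0// tn//; apply/cornerP; exists i.
have mpos : 0 < side n c (zpt m) by rewrite -zsideE zr_gt0.
have widE (i : 'I_3) :
    nth 0%N [:: t.1.1; t.1.2; t.2; m] (widen_ord (leqnSn 3) i) = corner t i.
  by case: i => [[|[|[|//]]] ?].
(* At a common point the functional is at most zero, yet it is a sum of nonnegative terms; so the
   term of the apex vanishes, and with it the weight. *)
have lm : l ord0 ord_max = 0.
  apply/eqP; rewrite eq_le l0 andbT -(pmulr_lle0 _ mpos).
  move: rhs0; rewrite -E big_ord_recr /= => /(le_trans _); apply.
  rewrite lerDr; apply: sumr_ge0 => i _; apply: mulr_ge0 => //.
  by rewrite widE.
exists (\row_i l ord0 (widen_ord (leqnSn 3) i)); split.
  split=> [i|]; first by rewrite mxE.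
  rewrite -l1 [RHS]big_ord_recr /= lm addr0.
  by apply: eq_bigr => i _; rewrite mxE.
rewrite [LHS]big_ord_recr /= lm scale0r addr0.
by apply: eq_bigr => i _; rewrite mxE widE.
Qed.
End Integral.

(** * The polyhedron and its finite checks *)

(* The base tetrahedron, then for each hat the top of the pyramid and the tips
   of its three spikes. *)
Definition vertices : seq zpoint :=
  let P (x y z : Z) : zpoint := (x, y, z) in
  [:: P 2 2 2; P 2 (-2) (-2); P (-2) 2 (-2); P (-2) (-2) 2;
    P 1 1 (-1); P 43 8 (-8); P 8 8 (-43); P 8 43 (-8);
    P 1 (-1) 1; P 43 (-8) 8; P 8 (-43) 8; P 8 (-8) 43;
    P (-1) 1 1; P (-8) 43 8; P (-43) 8 8; P (-8) 8 43;
    P (-1) (-1) (-1); P (-8) (-8) (-43); P (-43) (-8) (-8); P (-8) (-43) (-8)].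

Definition vertex (n : nat) : zpoint := nth (Z0, Z0, Z0) vertices n.

(** First the pyramid with top [m], then one spike on each of its sides, with tips [m+1], [m+2],
    [m+3]. *)
Definition hat_gluings (t : tri) (m : nat) : seq tri :=
  [:: t; (t.1.1, t.1.2, m); (t.1.2, t.2, m); (t.1.1, t.2, m)].

Definition gluings : seq tri :=
  hat_gluings (0, 1, 2)%N 4 ++ hat_gluings (0, 1, 3)%N 8 ++
  hat_gluings (0, 2, 3)%N 12 ++ hat_gluings (1, 2, 3)%N 16.

Definition surface : seq tri := stack_faces 4 gluings tet_faces.

(* In every hat each spike has one outer face and two inner faces, of areas in the
   ratio 12 : 7; this makes all layouts rational.  Hat [h] consists of the faces
   [9 h], ..., [9 h + 8] of [surface]. *)
Definition face_weight (f : nat) : Z := if (f %% 3 == 0)%N then 12 else 7.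

Definition barycenter (w : nat * nat * nat) : coords :=
  let q i := Qmake (Z.of_nat i) (Pos.of_nat (w.1.1 + w.1.2 + w.2)) in
  (q w.1.1, q w.1.2, q w.2).

(* The walks which overlap, with the barycentric coordinates of a common point in
   the last face.  In the last three, around the spikes, the first face comes back
   displaced and the coordinates are irrelevant. *)
Definition hat_walks : seq (seq nat * (nat * nat * nat)) :=
  [:: ([:: 0; 1; 5; 3], (1, 69, 1)); ([:: 0; 2; 8; 6], (1, 69, 1));
      ([:: 3; 4; 7; 6], (69, 1, 1));
      ([:: 1; 2; 8; 7; 4], (1, 9, 1)); ([:: 2; 1; 5; 4; 7], (1, 9, 1));
      ([:: 4; 5; 1; 2; 8], (1, 9, 1));
      ([:: 1; 5; 4; 7; 8], (17, 1, 1)); ([:: 2; 8; 7; 4; 5], (17, 1, 1));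
      ([:: 5; 1; 2; 8; 7], (17, 1, 1));
      ([:: 1; 5; 3; 4; 7], (1, 1, 2)); ([:: 2; 8; 6; 7; 4], (1, 1, 2));
      ([:: 5; 1; 0; 2; 8], (1, 1, 2));
      ([:: 0; 1; 2; 0], (1, 1, 1)); ([:: 3; 4; 5; 3], (1, 1, 1));
      ([:: 6; 7; 8; 6], (1, 1, 1))]%N.

Definition walks_of_hat (h : nat) : seq (seq nat * coords) :=
  [seq ([seq 9 * h + j | j <- w.1]%N, barycenter w.2) | w <- hat_walks].

Definition all_pairs (T : Type) (r : T -> T -> bool) (s : seq T) : bool :=
  all (fun x => all (r x) s) s.

Lemma all_pairsP (T : eqType) (r : T -> T -> bool) (s : seq T) x y :
  all_pairs r s -> x \in s -> y \in s -> r x y.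
Proof. by move=> /allP h /h /allP; apply. Qed.

(** The dual graph: ordering each pair makes every edge of the surface occur once. *)
Definition adjacencies : seq (nat * nat) :=
  [seq e <- [seq (f, g) | f <- iota 0 36, g <- iota 0 36] | (e.1 < e.2)%N &&
    (1 < count (mem (corners (face surface e.2))) (corners (face surface e.1)))%N].

Definition hat_adjacencies (h : nat) : seq (nat * nat) :=
  [seq e <- adjacencies | (e.1 %/ 9 == h)%N && (e.2 %/ 9 == h)%N].

Definition surface_hinge (e : nat * nat) : nat * nat := hinge surface e.1 e.2.

Definition hat_edges (h : nat) : seq (nat * nat) := map surface_hinge (hat_adjacencies h).

Definition walk_hinges (w : seq nat) : seq (nat * nat) :=
  walk_edges surface (head 0%N w) (behead w).

(** The second clause confines the crossed edges to the inner edges of hat [h], so that the bounds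
    of the four hats add up. *)
Definition hat_ok (h : nat) : bool :=
  let cl := [seq walk_hinges w.1 | w <- walks_of_hat h] in
  [&& all (fun w => overlapping surface (zdist vertex) face_weight w.1 w.2) (walks_of_hat h),
      all (all (mem (hat_edges h))) cl
    & hitting_number_geq (size (hat_edges h)) 5
        [seq [seq index e (hat_edges h) | e <- w] | w <- cl]].

Lemma hats_ok : all hat_ok (iota 0 4).
Proof. by vm_cast_no_check (erefl true). Qed.

Definition tri_nondegenerate (t : tri) : bool :=
  all (fun a => all (fun b => all (fun c =>
    perm_eq (corners t) [:: a; b; c] ==> (zheron vertex a b c != 0))
    (corners t)) (corners t)) (corners t).

Lemma surface_nondegenerate_ok : all tri_nondegenerate surface.
Proof. by vm_cast_no_check (erefl true). Qed.

(** Translates [share_edge], which names an edge by its ends in either order, into a listed pair of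
    faces. *)
Lemma adjacencies_ok : all_pairs (fun f g =>
  let s := corners (face surface f) in let t := corners (face surface g) in
  all_pairs (fun v w => [&& f != g, v != w, v \in t & w \in t] ==>
    let e := (minn f g, maxn f g) in
    (e \in adjacencies) &&
    ((surface_hinge e == (v, w)) || (surface_hinge e == (w, v)))) s) (iota 0 36).
Proof. by vm_cast_no_check (erefl true). Qed.

(** The pairs left over straddle two hats along an edge of the base tetrahedron. *)
Lemma adjacencies_split : perm_eq adjacencies
  (flatten [seq hat_adjacencies h | h <- iota 0 4] ++
   [seq e <- adjacencies | (e.1 %/ 9 != e.2 %/ 9)%N]).
Proof. by vm_cast_no_check (erefl true). Qed.

Definition no_flat_ok (F : seq tri) : bool :=
  all_pairs (fun t1 t2 =>
    (1 < count (mem (corners t2)) (corners t1))%N ==>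
    all (fun e => (e \notin corners t1) ==> (zdet vertex t1.1.1 t1.1.2 t1.2 e != 0))
      (corners t2)) F.

(* The candidate planes pass through three vertices of the two tetrahedra: an
   extreme ray of the cone of separating functionals vanishes on such a triple. *)
Definition separated (t : tri) (m : nat) (u : seq nat) : bool :=
  let s := t.1.1 :: t.1.2 :: t.2 :: m :: u in
  has (fun a => has (fun b => has (fun c =>
    let n := zcross (zsub (vertex b) (vertex a)) (zsub (vertex c) (vertex a)) in
    let n' := zsub (Z0, Z0, Z0) n in
    separates vertex n (zdot n (vertex a)) t m u ||
    separates vertex n' (zdot n' (vertex a)) t m u) s) s) s.

Definition tet_corners (s : seq tri) (j : nat) : seq nat :=
  let v := tet_verts s j in
  [:: v ord0; v (lift ord0 ord0); v (lift ord0 (lift ord0 ord0)); v ord_max].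

Lemma tet_cornersE s j : tet_corners s j = [seq tet_verts s j k | k <- enum 'I_4].
Proof.
by rewrite !enum_ordSl enum_ord0 /tet_corners /=; do 3 congr cons; congr [:: tet_verts s j _];
  apply: val_inj.
Qed.

(** The range [iota 3 (1 + i)] lists the tetrahedra present before step [i], number 3 being the
    initial one. *)
Lemma gluings_ok : all (fun i =>
  let t := nth (0, 0, 0)%N gluings i in
  [&& t \in faces_at gluings i, zdet vertex t.1.1 t.1.2 t.2 (4 + i) != 0
    & all (fun j => separated t (4 + i) (tet_corners gluings j)) (iota 3 (1 + i))])
  (iota 0 16).
Proof. by vm_cast_no_check (erefl true). Qed.

Lemma no_flat_all_ok : all (fun k => no_flat_ok (faces_at gluings k)) (iota 0 17).
Proof. by vm_cast_no_check (erefl true). Qed.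

Lemma size_adjacencies : size adjacencies = 54%N.
Proof. by vm_cast_no_check (erefl 54%N). Qed.

(* Unification would otherwise enumerate the adjacencies lazily. *)
#[local] Opaque adjacencies.

(** * Stackedness and the absence of a one-piece unfolding *)

Section Surface.
Variable R : realType.
Local Notation p := (zpt R vertex).

Lemma corner_count (t u : tri) (i j : 'I_3) : i != j ->
  corner t i \in corners u -> corner t j \in corners u ->
  (1 < count (mem (corners u)) (corners t))%N.
Proof.
case: i => [[|[|[|//]]] hi]; case: j => [[|[|[|//]]] hj] //= _;
  rewrite /corner /= => -> ->; lia.
Qed.

Lemma corner_inord (t : tri) :
  [/\ corner t ord0 = t.1.1, corner t (inord 1) = t.1.2 & corner t (inord 2) = t.2].
Proof. by rewrite /corner !inordK. Qed.

Lemma no_flat_sound F : no_flat_ok F -> no_flat_edges p F.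
Proof.
move=> ok t1 t2 t1F t2F i j k l ij ik jl e eN.
have cmem t (o : 'I_3) : corner t o \in corners t by apply/cornerP; exists o.
have e1 : corner t2 e \notin corners t1.
  by apply/negP => /cornerP[e' /eqP]; rewrite eq_sym (negPf (eN e')).
have /implyP H := all_pairsP ok t1F t2F.
have [-> -> ->] := corner_inord t1; apply: det4_neq0.
have cnt : (1 < count (mem (corners t2)) (corners t1))%N.
  by apply: (corner_count ij); rewrite ?ik ?jl.
by have /allP/(_ _ (cmem t2 e))/implyP := H cnt; apply.
Qed.

Lemma stacked_surface : stacked p gluings.
Proof.
split; first by apply: det4_neq0; vm_compute.
split=> [i hi t m|k hk].
- have /allP/(_ i) := gluings_ok; rewrite mem_iota hi => /(_ isT).
  rewrite -/t -/m => /and3P[tF dt /allP sep]; split=> //; first exact: det4_neq0.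
  move=> x xm [j [jm xj]].
  have jiota : j \in iota 3 (1 + i) by rewrite mem_iota; move: jm; rewrite /m; lia.
  have /hasP[a _ /hasP[b _ /hasP[b' _ ]]] := sep j jiota; rewrite tet_cornersE.
  (* Number [m] exceeds 3, so this tetrahedron is the glued triangle together with its apex. *)
  have {}xm : in_hull (fun k : 'I_4 => p (nth 0%N [:: t.1.1; t.1.2; t.2; m] k)) x.
    by move: xm; rewrite /in_tet /tet_verts leqNgt ltn_addr//= addKn.
  by case/orP=> sep_abc; exact: (separates_sound sep_abc xm xj).
- have /allP/(_ k) := no_flat_all_ok; rewrite mem_iota /= => H.
  by apply: no_flat_sound; apply: H; rewrite ltnS.
Qed.

Lemma surface_nondegenerate f : (f < size surface)%N -> forall a b c,
  perm_eq (corners (face surface f)) [:: a; b; c] -> nondegenerate (p a) (p b) (p c).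
Proof.
move=> fF a b c fp; apply: zheron_nondegenerate.
have := allP surface_nondegenerate_ok _ (mem_nth (0, 0, 0)%N fF).
have [ma mb mc] : [/\ a \in corners (face surface f), b \in corners (face surface f)
    & c \in corners (face surface f)].
  by rewrite !(perm_mem fp) !inE !eqxx !orbT.
by move=> /allP/(_ a ma)/allP/(_ b mb)/allP/(_ c mc)/implyP; apply.
Qed.

Lemma no_one_piece : ~ has_one_piece_edge_unfolding p surface.
Proof.
move=> [cut [L [conn iso glu inj _]]].
pose c (e : nat * nat) := is_cut cut e.1 e.2.
have hat h : (h < 4)%N -> (5 <= count (preim surface_hinge c) (hat_adjacencies h))%N.
  rewrite -count_map -/(hat_edges h) => h4; have /allP/(_ h) := hats_ok.
  rewrite mem_iota h4 => /(_ isT).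
  move=> /and3P[ov sub hit]; apply: count_hitting sub hit _.
  rewrite all_map; apply: sub_all ov => w wok.
  exact: (overlapping_sound iso glu inj surface_nondegenerate (zdistE R vertex) wok).
pose cutadj := preim surface_hinge c.
have cut20 : (20 <= count cutadj adjacencies)%N.
  have h5 : {in [seq hat_adjacencies h | h <- iota 0 4], forall x, (5 <= count cutadj x)%N}.
    by move=> _ /mapP[h + ->]; rewrite mem_iota; exact: hat.
  by have := count_flatten_geq adjacencies_split h5; rewrite size_map size_iota.
(* The uncut adjacencies are the edges of a connected graph on the 36 faces. *)
have : (36 <= (size [seq e <- adjacencies | ~~ cutadj e]).+1)%N.
  apply: (connected_leq_edges (r := glued surface cut)) conn.
  move=> f g [v [w [[fF [gF [fg [vw [[i [j [iv jw]]] [k [l [kv lw]]]]]]]] nc]]].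
  have := all_pairsP adjacencies_ok (x := f) (y := g).
  rewrite !mem_iota => /(_ fF gF) /= H.
  have := all_pairsP H (x := v) (y := w).
  have vf : v \in corners (face surface f) by apply/cornerP; exists i.
  have wf : w \in corners (face surface f) by apply/cornerP; exists j.
  have vg : v \in corners (face surface g) by apply/cornerP; exists k.
  have wg : w \in corners (face surface g) by apply/cornerP; exists l.
  move=> /(_ vf wf); rewrite vg wg; move/eqP: fg => -> ; move/eqP: vw => -> /=.
  move=> /andP[eA eh].
  have : (minn f g, maxn f g) \in [seq e <- adjacencies | ~~ cutadj e].
    rewrite mem_filter eA andbT /cutadj /= /c.
    (* [is_cut] is symmetric, so the orientation of the hinge does not matter. *)
    by case/orP: eh => /eqP -> //=; rewrite /is_cut orbC.
  by rewrite /minn /maxn; case: ifP => _; [left|right].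
(* At least 20 cut and at least 35 uncut adjacencies exceed the total of 54. *)
rewrite ltnS size_filter; have := count_predC cutadj adjacencies.
rewrite size_adjacencies.
by rewrite (@eq_count _ (predC cutadj) (fun e => ~~ cutadj e))//; lia.
Qed.
End Surface.

Theorem theorem2 (R : realType) :
  exists (p : nat -> 'rV[R]_3) (s : seq tri),
    stacked p s /\ ~ has_one_piece_edge_unfolding p (stack_faces 4 s tet_faces).
Proof.
exists (zpt R vertex), gluings.
by split; [exact: stacked_surface|exact: no_one_piece].
Qed.
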